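(* Let $G=(V,E)$ be a simple, connected, undirected graph on $n$ vertices with at least one edge. If $G$ is totally conformally rigid, then $w=\mathbf{1}$ maximizes $\tau(G,w)=\sum_T\prod_{e\in T}w_e$ over all $w\in\Delta_E$, where the sum is over all spanning trees $T$ of $G$.
   Context: $\mathbf{1}\in\mathbb{R}^E$ is all-ones, $\Delta_E=\{w\in\mathbb{R}^E:w\ge0,\ \mathbf{1}^Tw=|E|\}$. For $w\in\mathbb{R}^E$, $\mathcal{L}(w)=\sum_{ab\in E}w_{ab}(e_a-e_b)(e_a-e_b)^T$ with eigenvalues $0=\lambda_1(w)\le\dots\le\lambda_n(w)$; $S_k(w)$, $s_k(w)$ denote the sums of the $k$ largest, resp. $k$ smallest, among $\lambda_2(w),\dots,\lambda_n(w)$. $G$ is totally conformally rigid if for every $k\in\{1,\dots,n-1\}$ and all $w,w'\in\Delta_E$, $s_k(w)\le s_k(\mathbf{1})\le S_k(\mathbf{1})\le S_k(w')$. *)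

(* Defs.v *)
From mathcomp Require Import all_boot all_order all_algebra.
From mathcomp Require Import boolp reals polyrcf.

Set Implicit Arguments.
Unset Strict Implicit.
Unset Printing Implicit Defensive.

Import Order.TTheory GRing.Theory Num.Theory.

Local Open Scope ring_scope.

(* A simple graph is a symmetric irreflexive relation on a finite type. *)
Section Graph.
Variables (V : finType) (adj : rel V).

(* Each undirected edge ab is counted once: it is represented by the pair of
   its endpoints listed in the enumeration order of V. *)
Definition edge : Type :=
  {p : V * V | adj p.1 p.2 && (enum_rank p.1 < enum_rank p.2)%N}.

Definition src (f : edge) : V := (val f).1.
Definition tgt (f : edge) : V := (val f).2.

Definition edge_rel (T : {set edge}) : rel V := fun x y =>
  [exists f in T, (x == src f) && (y == tgt f) || (x == tgt f) && (y == src f)].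

End Graph.

Definition connected (V : finType) (r : rel V) : Prop :=
  forall x y : V, connect r x y.

(* In a simple graph, cycles are the closed walks c_1 ... c_m c_1 with the c_i
   pairwise distinct and m >= 3; [ucycle] alone also admits m <= 2. *)
Definition acyclic (V : finType) (r : rel V) : Prop :=
  forall c : seq V, ucycle r c -> (size c <= 2)%N.

Definition spanning_tree (V : finType) (adj : rel V) (T : {set edge adj}) : Prop :=
  connected (edge_rel T) /\ acyclic (edge_rel T).

Section Weights.
Variables (R : realType) (V : finType) (adj : rel V).

Local Notation weights := {ffun edge adj -> R}.

Definition ones : weights := [ffun=> 1].

Definition normalized (w : weights) : Prop :=
  (forall f, 0 <= w f) /\ \sum_f w f = #|{: edge adj}|%:R.

Definition tau (w : weights) : R :=
  \sum_(T : {set edge adj} | `[< spanning_tree T >]) \prod_(f in T) w f.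

Definition basis_vec (a : V) : 'cV[R]_#|V| := delta_mx (enum_rank a) 0.

Definition laplacian (w : weights) : 'M[R]_#|V| :=
  \sum_(f : edge adj)
     w f *: ((basis_vec (src f) - basis_vec (tgt f))
               *m (basis_vec (src f) - basis_vec (tgt f))^T).

End Weights.

(* The real eigenvalues in increasing order, with algebraic multiplicity; for a
   symmetric A these are all n of them. *)
Definition eigenvalues (R : realType) (n : nat) (A : 'M[R]_n) : seq R :=
  sort <=%R
    (flatten [seq nseq (mup x (char_poly A)) x | x <- rootsR (char_poly A)]).

Section Spectrum.
Variables (R : realType) (V : finType) (adj : rel V).
Implicit Types w : {ffun edge adj -> R}.

(* lambda_2 <= ... <= lambda_n *)
Definition spectrum w : seq R := behead (eigenvalues (laplacian w)).

Definition sum_smallest (k : nat) w : R := \sum_(x <- take k (spectrum w)) x.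

Definition sum_largest (k : nat) w : R :=
  \sum_(x <- take k (rev (spectrum w))) x.

End Spectrum.

Definition totally_conformally_rigid (R : realType) (V : finType)
    (adj : rel V) : Prop :=
  forall k : nat, (1 <= k <= #|V| - 1)%N ->
  forall w w' : {ffun edge adj -> R}, normalized w -> normalized w' ->
    [/\ sum_smallest k w <= sum_smallest k (ones R adj),
        sum_smallest k (ones R adj) <= sum_largest k (ones R adj) &
        sum_largest k (ones R adj) <= sum_largest k w'].

(* Main.v *)
(* Rigidity bounds every partial sum of the increasing list lambda_2, ..., lambda_n of
   Laplacian eigenvalues of w by the corresponding partial sum for the all-ones
   weight.  Write x_i and y_i for the two lists.  The weights 1 / y_i decrease,
   so Abel summation gives sum_i x_i / y_i <= n - 1, and AM-GM turns this into
   prod_i x_i <= prod_i y_i.  By the weighted matrix-tree theorem these products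
   are n tau(w) and n tau(1).

   The matrix-tree theorem is obtained from the Cauchy-Binet formula applied to
   L + e_r^T e_r, where r is a root vertex: the Gram determinant of n incidence
   vectors (one of them e_r) vanishes unless the edges form a spanning tree, and
   is 1 for a tree since the incidence matrix then has an integral inverse.
   Finally, the matrices L and 1 e_r have product 0, so their characteristic
   polynomials multiply to X^n char(L + 1 e_r), which identifies the product of
   the eigenvalues of L other than the first with det(L + 1 e_r). *)
Require Import Defs.
From mathcomp Require Import all_boot all_order all_algebra all_fingroup.
From mathcomp Require Import boolp reals polyrcf complex ring.

Set Implicit Arguments.
Unset Strict Implicit.
Unset Printing Implicit Defensive.

Import Order.TTheory GRing.Theory Num.Theory.

Local Open Scope ring_scope.

(** * Sums of rank-one matrices *)

Section RankOneSums.
Variables (R : comNzRingType) (I : finType) (n : nat) (b : I -> 'rV[R]_n).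

(** Distributing the Leibniz formula over the entry sums picks an index [f k] for each row [k]; a
    non-injective choice repeats a row, so its determinant vanishes. *)
Lemma det_sum_rank1_inj (w : I -> R) :
  \det (\sum_i w i *: ((b i)^T *m b i)) =
  \sum_(f : {ffun 'I_n -> I} | injectiveb f)
    (\prod_k w (f k)) *
      ((\prod_k b (f k) 0 k) * \det (\matrix_(k, j) b (f k) 0 j)).
Proof.
transitivity (\sum_(f : {ffun 'I_n -> I})
    (\prod_k w (f k)) *
      ((\prod_k b (f k) 0 k) * \det (\matrix_(k, j) b (f k) 0 j))).
  pose F s k i := w i * b i 0 k * b i 0 ((s : 'S_n) k).
  transitivity (\sum_(s : 'S_n) \sum_(f : {ffun 'I_n -> I})
      (-1) ^+ s * \prod_k F s k (f k)).
    apply: eq_bigr => s _; rewrite -big_distrr /= -(bigA_distr_bigA (F s)) /=.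
    congr (_ * _); apply: eq_bigr => k _; rewrite summxE.
    by apply: eq_bigr => i _; rewrite !mxE big_ord1 !mxE mulrA.
  rewrite exchange_big; apply: eq_bigr => /= f _.
  rewrite /determinant mulrA big_distrr /=; apply: eq_bigr => s _.
  rewrite !big_split /= [RHS]mulrCA.
  by congr (_ * (_ * _)); apply: eq_bigr => k _; rewrite mxE.
rewrite (bigID (fun f : {ffun _} => injectiveb f)) /= addrC big1 ?add0r //.
move=> f /injectivePn[k1 [k2 Dk Ef]].
by rewrite (determinant_alternate Dk) ?mulr0 // => j; rewrite !mxE Ef.
Qed.

(** Cauchy-Binet, with each squared minor written as a Gram determinant: the injective choices are
    grouped by image. *)
Lemma det_sum_rank1 (w : I -> R) :
  \det (\sum_i w i *: ((b i)^T *m b i)) =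
  \sum_(S : {set I} | #|S| == n)
    (\prod_(i in S) w i) * \det (\sum_(i in S) (b i)^T *m b i).
Proof.
have im_card (f : {ffun 'I_n -> I}) : injectiveb f -> #|f @: 'I_n| == n.
  by move/injectiveP=> f_inj; rewrite card_imset // card_ord.
rewrite det_sum_rank1_inj.
rewrite (partition_big (fun f : {ffun 'I_n -> I} => f @: 'I_n)
  (fun S : {set I} => #|S| == n)) /=; last exact: im_card.
apply: eq_bigr => S /eqP cardS.
have -> : \sum_(i in S) (b i)^T *m b i = \sum_i (i \in S)%:R *: ((b i)^T *m b i).
  rewrite big_mkcond; apply: eq_bigr => i _.
  by case: (i \in S); rewrite ?scale1r ?scale0r.
(* The same expansion, weighted by the indicator of [S], keeps only the choices with image [S]: an
   injective choice with another image takes a value outside [S]. *)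
rewrite det_sum_rank1_inj big_distrr /=.
rewrite [RHS](bigID (fun f : {ffun 'I_n -> I} => f @: 'I_n == S)) /=.
rewrite [X in _ = _ + X]big1 ?addr0 => [|f /andP[/injectiveP f_inj imfS]].
  apply: eq_bigr => f /andP[/injectiveP f_inj /eqP imfS].
  rewrite [X in _ = _ * (X * _)]big1 ?mul1r => [|k _]; last by rewrite -imfS imset_f.
  by rewrite -imfS big_imset //= => x y _ _ /f_inj.
suff /forallPn[k kNS] : ~~ [forall k, f k \in S].
  by rewrite (bigD1 k) //= (negPf kNS) !mul0r mulr0.
apply: contra imfS => /forallP fS; rewrite eqEcard cardS card_imset //.
rewrite card_ord leqnn andbT.
by apply/subsetP => _ /imsetP[k _ ->].
Qed.
End RankOneSums.

(** The two sides are read off two block triangular factorizations of one matrix. *)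
Lemma det_1_add_rank1 (R : comNzRingType) n (u : 'cV[R]_n) (v : 'rV[R]_n) :
  \det (1%:M + u *m v) = 1 + (v *m u) 0 0.
Proof.
have E1 : block_mx 1%:M (- v) u 1%:M =
          block_mx 1%:M 0 u 1%:M *m block_mx 1%:M (- v) 0 (1%:M + u *m v).
  rewrite mulmx_block !mulmx1 !mul1mx !mul0mx ?mulmx0 !addr0 mulmxN.
  by rewrite addrCA addNr addr0.
have E2 : block_mx 1%:M (- v) u 1%:M =
          block_mx 1%:M (-v) 0 1%:M *m block_mx (1%:M + v *m u) 0 u 1%:M.
  rewrite mulmx_block !mulmx1 !mul1mx !mul0mx ?mulmx0 !add0r mulNmx.
  by rewrite addrK.
have := congr1 determinant E1.
rewrite {1}E2 !det_mulmx !det_ublock !det_lblock !det1 !mul1r !mulr1.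
by move=> <-; rewrite det_mx11 !mxE eqxx.
Qed.

(** * Partial sums and products *)

Lemma ler_sum_mul_nonincreasing (R : realFieldType) (n : nat) (c x y : nat -> R) :
    (forall i, (i < n)%N -> 0 <= c i) ->
    (forall i, (i.+1 < n)%N -> c i.+1 <= c i) ->
    (forall k, (k <= n)%N -> \sum_(i < k) x i <= \sum_(i < k) y i) ->
  \sum_(i < n) c i * x i <= \sum_(i < n) c i * y i.
Proof.
move=> c_ge0 c_dec le_xy; pose z i := y i - x i.
have z_ge0 k : (k <= n)%N -> 0 <= \sum_(i < k) z i.
  by move=> /le_xy; rewrite /z sumrB subr_ge0.
rewrite -subr_ge0 -sumrB; under eq_bigr do rewrite -mulrBr.
(* Abel summation as an induction: replacing [c m] by the smaller [c m.+1] only shrinks the left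
   side, because the partial sums of [z] are nonnegative. *)
suff H m : (m.+1 <= n)%N -> c m * \sum_(i < m.+1) z i <= \sum_(i < m.+1) c i * z i.
  case: n c_ge0 H z_ge0 {c_dec le_xy} => [|n] c_ge0 H z_ge0; first by rewrite big_ord0.
  by apply: le_trans (H n _) => //; rewrite mulr_ge0 ?c_ge0 ?z_ge0.
elim: m => [|m IHm] lt_mn; first by rewrite !big_ord1.
rewrite [in leRHS]big_ord_recr [in leLHS]big_ord_recr /= mulrDr lerD2r.
apply: le_trans (IHm (ltnW lt_mn)); apply: ler_wpM2r; first exact/z_ge0/ltnW.
exact: c_dec.
Qed.

Lemma ler_prod_of_ler_partial_sums (R : realFieldType) (n : nat) (x y : nat -> R) :
    (forall i, (i < n)%N -> 0 <= x i) ->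
    (forall i, (i < n)%N -> 0 <= y i) ->
    (forall i, (i.+1 < n)%N -> y i <= y i.+1) ->
    (forall k, (k <= n)%N -> \sum_(i < k) x i <= \sum_(i < k) y i) ->
  \prod_(i < n) x i <= \prod_(i < n) y i.
Proof.
move=> x_ge0 y_ge0 y_inc le_xy.
case: (posnP n) => [-> | n_gt0]; first by rewrite !big_ord0.
(* If [y 0] is zero, so are [x 0] and the left product; otherwise monotonicity makes every [y i]
   positive and division possible. *)
have [y0 | y0_neq0] := eqVneq (y 0%N) 0.
  have x0 : x 0%N = 0.
    apply/eqP; rewrite eq_le x_ge0 // andbT -y0.
    by have := le_xy 1%N n_gt0; rewrite !big_ord1.
  by rewrite (bigD1 (Ordinal n_gt0)) //= x0 mul0r; apply: prodr_ge0 => i _; apply: y_ge0.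
have y_gt0 i : (i < n)%N -> 0 < y i.
  elim: i => [|i IHi] lt_in; first by rewrite lt_def y0_neq0 y_ge0.
  exact: lt_le_trans (IHi (ltnW lt_in)) (y_inc _ lt_in).
have py_gt0 : 0 < \prod_(i < n) y i by apply: prodr_gt0 => i _; apply: y_gt0.
rewrite -[leRHS]mul1r -ler_pdivrMr // -prodf_div.
have le_sum : \sum_(i < n) x i / y i <= n%:R.
  have -> : n%:R = \sum_(i < n) (y i)^-1 * y i.
    under eq_bigr => i _ do rewrite mulVf ?gt_eqF ?y_gt0 //.
    by rewrite sumr_const card_ord.
  under eq_bigr do rewrite mulrC.
  apply: (ler_sum_mul_nonincreasing (c := fun i => (y i)^-1)) => // i lt_in.
    by rewrite invr_ge0 y_ge0.
  by rewrite lef_pV2 ?posrE ?y_gt0 ?y_inc // ltnW.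
have q_ge0 (i : 'I_n) : 0 <= x i / y i by rewrite divr_ge0 ?x_ge0 ?y_ge0.
have [+ _] := leif_AGM (A := {: 'I_n})
  (E := fun i : 'I_n => x i / y i) (fun i _ => q_ge0 i).
move/le_trans; apply; rewrite card_ord; apply: exprn_ile1.
  by rewrite divr_ge0 ?ler0n // sumr_ge0.
by rewrite ler_pdivrMr ?ltr0n // mul1r.
Qed.

(** * Characteristic polynomials and eigenvalues *)

Lemma char_poly_similar (R : comUnitRingType) n (P A B : 'M[R]_n) :
  P \in unitmx -> A = invmx P *m B *m P -> char_poly A = char_poly B.
Proof.
move=> uP ->; rewrite /char_poly.
have -> : char_poly_mx (invmx P *m B *m P) =
    map_mx polyC (invmx P) *m char_poly_mx B *m map_mx polyC P.
  rewrite /char_poly_mx mulmxBr mulmxBl -!map_mxM; congr (_ - _).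
  by rewrite mul_mx_scalar -scalemxAl -map_mxM mulVmx // map_mx1 scalemx1.
rewrite !det_mulmx mulrAC -det_mulmx -map_mxM mulVmx //.
by rewrite map_mx1 det1 mul1r.
Qed.

(** Over [R[i]] the matrix is Hermitian, hence unitarily diagonalizable with a real diagonal; the
    factorization descends to [R] because extension of coefficients is injective. *)
Lemma char_poly_symmetric_split (R : realType) n (A : 'M[R]_n) :
  A^T = A -> exists s : seq R, char_poly A = \prod_(x <- s) ('X - x%:P).
Proof.
move=> symA; pose C := R[i]; pose toC := real_complex R : {rmorphism R -> C}.
pose AC := map_mx toC A.
have realAC : AC \is a mxOver (Num.real : {pred C}).
  by apply/mxOverP => i j; rewrite mxE complex_real.
have symAC : AC \is hermsymmx.
  apply: realsym_hermsym => //; apply/is_hermitianmxP.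
  by rewrite expr0 scale1r map_mx_id // /AC map_trmx symA.
have /hermitian_normalmx/orthomx_spectralP := symAC.
move/(char_poly_similar (spectral_unit _)).
rewrite (char_poly_trig (diag_mx_is_trig _)) => charAC.
exists [seq complex.Re (spectral_diag AC 0 i) | i <- enum 'I_n].
apply: (@map_poly_inj _ _ toC); rewrite map_char_poly -/AC charAC.
rewrite big_map big_enum /= rmorph_prod; apply: eq_bigr => i _.
rewrite rmorphB /= map_polyX map_polyC /= mxE eqxx mulr1n; congr (_ - _%:P).
apply/esym/RRe_real; have /mxOverP := hermitian_spectral_diag_real symAC; exact.
Qed.

Lemma mup_prod_XsubC (R : fieldType) (s : seq R) x :
  mup x (\prod_(y <- s) ('X - y%:P)) = count_mem x s.
Proof.
elim: s => [|y s IHs]; first by rewrite big_nil mupNroot // root1.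
rewrite big_cons mupM ?polyXsubC_eq0 ?monic_neq0 ?monic_prod_XsubC // IHs.
by have := mup_XsubCX 1 x y; rewrite expr1 /= => ->; case: (y == x).
Qed.

(** [rootsR] lists each root once, so [x] occurs as often as its multiplicity, which is its count in
    [s]. *)
Lemma perm_eigenvalues (R : realType) n (A : 'M[R]_n) (s : seq R) :
  char_poly A = \prod_(x <- s) ('X - x%:P) -> perm_eq (eigenvalues A) s.
Proof.
move=> charA; rewrite /eigenvalues perm_sort; apply/allP => x _ /=.
have nz : char_poly A != 0 by rewrite monic_neq0 ?char_poly_monic.
rewrite -[in X in _ == X]mup_prod_XsubC -charA count_flatten -map_comp.
rewrite sumnE big_map; apply/eqP.
under eq_bigr do rewrite /= count_nseq /=.
have [xr | xNr] := boolP (x \in rootsR (char_poly A)).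
  rewrite (bigD1_seq x) ?uniq_roots //= eqxx mul1n big1 ?addn0 // => y /negPf yx.
  by rewrite yx.
rewrite big1_seq => [|y /andP[_ yr]].
  rewrite mupNroot //; apply: contra xNr => xr.
  by have := roots_on_rootsR nz x; rewrite in_itv /= xr.
by case: eqP => // yx; rewrite -yx yr in xNr.
Qed.

Lemma prod_eigenvalues (R : realType) n (A : 'M[R]_n) :
  A^T = A -> char_poly A = \prod_(x <- eigenvalues A) ('X - x%:P).
Proof.
move=> /char_poly_symmetric_split[s charA].
by rewrite (perm_big _ (perm_eigenvalues charA)).
Qed.

(** [('X - A)('X - N) = 'X('X - (A + N)) + A N], where the last term is 0; then take
    determinants. *)
Lemma char_poly_add_annihilated (R : idomainType) n (A N : 'M[R]_n) :
  A *m N = 0 -> char_poly A * char_poly N = 'X ^+ n * char_poly (A + N).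
Proof.
move=> AN0; rewrite -detZ /char_poly -det_mulmx; congr determinant.
rewrite /char_poly_mx mulmxBl !mulmxBr -map_mxM AN0 map_mx0 subr0.
rewrite !mul_scalar_mx !mul_mx_scalar scale_scalar_mx map_mxD scalerBr scalerDr.
by rewrite scale_scalar_mx opprD addrA addrAC.
Qed.

(** * Acyclic sets of edges *)

Section EdgeRel.
Variables (V : finType) (adj : rel V).
Implicit Types (S T : {set edge adj}) (e f : edge adj).

Lemma edge_rel_sym S : symmetric (edge_rel S).
Proof.
suff H x y : edge_rel S x y -> edge_rel S y x by move=> x y; apply/idP/idP; apply: H.
case/existsP=> f /andP[fS xy]; apply/existsP; exists f; rewrite fS /=.
by rewrite orbC [(y == _) && _]andbC [(y == _) && _]andbC.
Qed.

Lemma connect_edge_sym S : connect_sym (edge_rel S).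
Proof. exact/sym_connect_sym/edge_rel_sym. Qed.

Lemma edge_relP S x y :
  reflect (exists2 f, f \in S & x = src f /\ y = tgt f \/ x = tgt f /\ y = src f)
          (edge_rel S x y).
Proof.
apply: (iffP existsP) => [[f /andP[fS xy]] | [f fS xy]]; exists f => //.
  by case/orP: xy => /andP[/eqP-> /eqP->]; [left | right].
by rewrite fS /=; case: xy => -[-> ->]; rewrite !eqxx ?orbT.
Qed.

Lemma edge_rel_edge S f : f \in S -> edge_rel S (src f) (tgt f).
Proof. by move=> fS; apply/edge_relP; exists f => //; left. Qed.

Lemma enum_rank_edge f : (enum_rank (src f) < enum_rank (tgt f))%N.
Proof. by case/andP: (valP f). Qed.

Lemma src_neq_tgt f : src f != tgt f.
Proof. by apply: contraTneq (enum_rank_edge f) => ->; rewrite ltnn. Qed.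

(** Edges are oriented by enumeration rank, which rules out the swapped case. *)
Lemma edge_ends_inj e f :
    src e = src f /\ tgt e = tgt f \/ src e = tgt f /\ tgt e = src f ->
  e = f.
Proof.
case=> -[Es Et]; last first.
  by have := enum_rank_edge e; rewrite Es Et ltnNge (ltnW (enum_rank_edge f)).
by apply: val_inj; rewrite [LHS]surjective_pairing [RHS]surjective_pairing; congr pair.
Qed.

(** Removing an edge from a cycle leaves a path between its ends, and a simple path avoiding an edge
    closes up with it into a cycle. *)
Lemma acyclic_edge_rel S :
  acyclic (edge_rel S) <->
  (forall e, e \in S -> ~~ connect (edge_rel (S :\ e)) (src e) (tgt e)).
Proof.
have sub e x y : edge_rel (S :\ e) x y -> edge_rel S x y.
  by case/edge_relP=> f /setD1P[_ fS] xy; apply/edge_relP; exists f.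
split=> [acyc e eS | noconn c /andP[cyc_c uniq_c]].
  apply/negP => /connectP[p0 path_p0 last_p0].
  case/shortenP: path_p0 last_p0 => p path_p uniq_p _ last_p.
  have : (size (src e :: p) <= 2)%N.
    apply: acyc; rewrite /ucycle uniq_p andbT /= rcons_path (sub_path (sub e)) //=.
    by rewrite -last_p edge_rel_sym edge_rel_edge.
  (* So short a path is empty or a single step: the first would make [e] a loop, the second would
     use [e] itself, which was removed. *)
  case: p path_p last_p {uniq_p} => [|y [|//]] /= path_p last_p _.
    by have := src_neq_tgt e; rewrite last_p eqxx.
  move: path_p; rewrite andbT -last_p => /edge_relP[f /setD1P[fNe _]] ends_f.
  by move: fNe; rewrite (edge_ends_inj ends_f) eqxx.
case: c => [|x [|y [|z p]]] //= in cyc_c uniq_c *.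
have /andP[/edge_relP[e eS ends_e] path_c] := cyc_c.
suff : connect (edge_rel (S :\ e)) y x.
  move=> conn_yx; have := noconn e eS.
  by case: ends_e conn_yx => -[<- <-]; rewrite 1?connect_edge_sym => ->.
have in_De u v : edge_rel S u v -> ~~ ((u == x) && (v == y) || (u == y) && (v == x)) ->
    edge_rel (S :\ e) u v.
  case/edge_relP=> f fS ends_f not_xy; apply/edge_relP; exists f => //.
  rewrite !inE fS andbT; apply: contra not_xy => /eqP fe; rewrite fe in ends_f.
  by case: ends_e => -[-> ->]; case: ends_f => -[-> ->]; rewrite !eqxx ?orbT.
have /and3P[xN yN _] := uniq_c.
have [xy xz] : x != y /\ x != z by move: xN; rewrite !inE !negb_or => /and3P[].
move: path_c; rewrite /= rcons_path => /and3P[yz path_p last_x].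
apply/connectP; exists (rcons (z :: p) x); last by rewrite last_rcons.
(* The rest of the cycle goes from [y] to [z], along [p], and back to [x]; by uniqueness none of
   these steps joins [x] and [y]. *)
rewrite rcons_path /= -andbA; apply/and3P; split.
- by apply: in_De => //; rewrite negb_or !negb_and eq_sym xy [z == x]eq_sym xz orbT.
- have : all (predC1 x) (z :: p).
    apply/allP => u up /=; apply: contraNneq xN => <-; by rewrite inE up orbT.
  elim: (p) z path_p {yN xN xz last_x yz cyc_c uniq_c} => //= u q IHq z.
  move=> /andP[zu path_q] /and3P[zx ux q_x].
  by rewrite IHq ?ux // in_De // negb_or !negb_and zx ux orbT.
have yl : y != last z p by apply: contraNneq yN => ->; apply: mem_last.
by apply: in_De => //; rewrite negb_or !negb_and xy orbT [_ == y]eq_sym yl.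
Qed.

End EdgeRel.

(** * Weighted matrix-tree theorem *)

(** The determinant of [B] is a unit among the integers, so its square is 1. The sizes are kept as
    [m] and [n] since they will be cardinals that are only provably equal. *)
Lemma det_unimodular_gram m n (B : 'M[int]_(m, n)) (D : 'M[int]_(n, m)) :
  B *m D = 1%:M -> m = n -> \det (B^T *m B) = 1.
Proof.
move=> BD1 Emn; subst n.
rewrite det_mulmx det_tr -expr2.
have : \det B * \det D == 1 by rewrite -det_mulmx BD1 det1.
move/eqP=> BD; have : \det B \is a GRing.unit.
  by apply/unitrPr; exists (\det D).
by rewrite unfold_in /= => /orP[]/eqP->.
Qed.

Section RootedIncidence.
Variables (V : finType) (adj : rel V) (r : V).

Definition vertex_row (K : pzRingType) (x : V) : 'rV[K]_#|V| :=
  delta_mx 0 (enum_rank x).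

(* [None] stands for a half-edge attached to the root: adding it turns the
   incidence vectors of a spanning tree into a basis. *)
Definition rooted_incidence (K : pzRingType) (o : option (edge adj)) : 'rV[K]_#|V| :=
  if o is Some f then vertex_row K (src f) - vertex_row K (tgt f)
  else vertex_row K r.

Definition rooted (T : {set edge adj}) : {set option (edge adj)} :=
  None |: [set Some f | f in T].

Lemma mem_rooted T o : (o \in rooted T) = if o is Some f then f \in T else true.
Proof.
rewrite !inE; case: o => [f|] //=; apply/imsetP/idP => [[g gT [->]] // | fT].
by exists f.
Qed.

Lemma card_rooted T : #|rooted T| = #|T|.+1.
Proof.
rewrite cardsU1 card_imset; last exact: Some_inj.
by case: imsetP => [[]|].
Qed.

Lemma vertex_row_mul (K : pzRingType) (x : V) (d : 'cV[K]_#|V|) :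
  vertex_row K x *m d = (d (enum_rank x) 0)%:M.
Proof. by rewrite -rowE [LHS]mx11_scalar mxE. Qed.

Lemma vertex_potential_mul (K : pzRingType) (d : V -> K) (x : V) :
  vertex_row K x *m (\col_i d (enum_val i)) = (d x)%:M.
Proof. by rewrite vertex_row_mul mxE enum_rankK. Qed.

Lemma edge_potential_mul (K : pzRingType) (d : V -> K) (f : edge adj) :
  rooted_incidence K (Some f) *m (\col_i d (enum_val i)) = (d (src f) - d (tgt f))%:M.
Proof. by rewrite mulmxBl !vertex_potential_mul raddfB. Qed.

Section Field.
Variable K : fieldType.

(** The difference telescopes along a path, each step being an incidence vector up to sign. *)
Lemma connect_sub_incidence (T : {set edge adj}) x y :
  connect (edge_rel T) x y ->
  (vertex_row K x - vertex_row K y <=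
     \sum_(f in T) <<rooted_incidence K (Some f)>>)%MS.
Proof.
case/connectP=> p; elim: p x => [|z p IHp] x /=.
  by move=> _ ->; rewrite subrr sub0mx.
case/andP=> /edge_relP[f fT ends_f] path_p last_p.
rewrite -(subrKA (vertex_row K z)) addmx_sub ?IHp //.
apply: submx_trans (sumsmx_sup _ fT (submx_refl _)); rewrite genmxE.
by case: ends_f => -[-> ->] //=; rewrite -opprB eqmx_opp.
Qed.

Definition gram (S : {set option (edge adj)}) : 'M[K]_#|V| :=
  \sum_(o in S) (rooted_incidence K o)^T *m rooted_incidence K o.

Lemma det_gram_cokernel (S : {set option (edge adj)}) (d : 'cV[K]_#|V|) :
    d != 0 -> (forall o, o \in S -> rooted_incidence K o *m d = 0) ->
  \det (gram S) = 0.
Proof.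
move=> nz_d Sd0; apply/eqP/det0P; exists d^T; first by rewrite trmx_eq0.
rewrite /gram mulmx_sumr big1 // => o /Sd0 od0.
by rewrite mulmxA -trmx_mul od0 trmx0 mul0mx.
Qed.

(** Read as a column, [d] is a nonzero vector killed by every incidence vector of [S], so the Gram
    matrix is singular. *)
Lemma det_gram_potential (S : {set option (edge adj)}) (d : V -> K) (x : V) :
    d x != 0 -> (None \in S -> d r = 0) ->
    (forall f, Some f \in S -> d (src f) = d (tgt f)) ->
  \det (gram S) = 0.
Proof.
move=> dx dr dS; apply: (@det_gram_cokernel _ (\col_i d (enum_val i))).
  apply: contraNneq dx => /matrixP/(_ (enum_rank x) 0).
  by rewrite !mxE enum_rankK => ->.
case=> [f /dS df | /dr d0]; first by rewrite edge_potential_mul df subrr raddf0.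
by rewrite vertex_potential_mul d0 raddf0.
Qed.

Lemma det_gram_unrooted (S : {set option (edge adj)}) :
  None \notin S -> \det (gram S) = 0.
Proof.
by move=> /negPf NS; apply: (@det_gram_potential _ (fun=> 1) r); rewrite ?oner_eq0 ?NS.
Qed.

Lemma det_gram_disconnected T :
  ~ connected (edge_rel T) -> \det (gram (rooted T)) = 0.
Proof.
move=> disconn; have [x Nrx] : exists x, ~~ connect (edge_rel T) r x.
  apply: contrapT => conn_r; apply: disconn => x y.
  have conn z : connect (edge_rel T) r z.
    by apply: contrapT => /negP Nz; apply: conn_r; exists z.
  by apply: connect_trans (conn y); rewrite connect_edge_sym.
(* The potential is the indicator of the component of [x], which misses the root. *)
apply: (@det_gram_potential _ (fun v => (connect (edge_rel T) x v)%:R) x).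
- by rewrite connect0 oner_eq0.
- by rewrite connect_edge_sym (negPf Nrx).
move=> f; rewrite mem_rooted => /edge_rel_edge/connect1 conn_f.
by rewrite (same_connect_r (@connect_edge_sym _ _ T) conn_f).
Qed.

Lemma rank_sum_gen_le (S : {set option (edge adj)}) :
  (\rank (\sum_(o in S) <<rooted_incidence K o>>)%MS <= #|S|)%N.
Proof.
apply: leq_trans (mxrank_sum_leqif _) _ => /=.
rewrite -[leqRHS]sum1_card leq_sum // => o _.
by rewrite mxrank_gen rank_leq_row.
Qed.

(** The vector of an edge on a cycle lies in the span of the other vectors, so the Gram matrix has
    rank below [#|V|]. *)
Lemma det_gram_cyclic T :
    #|rooted T| = #|V| -> ~ acyclic (edge_rel T) ->
  \det (gram (rooted T)) = 0.
Proof.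
move=> cardT; rewrite acyclic_edge_rel => cyc.
have [e eT conn_e] : exists2 e, e \in T & connect (edge_rel (T :\ e)) (src e) (tgt e).
  apply: contrapT => no_e; apply: cyc => e eT; apply/negP => conn_e.
  by apply: no_e; exists e.
have eS : Some e \in rooted T by rewrite mem_rooted.
have sub_e : (rooted_incidence K (Some e) <=
    \sum_(o in rooted T :\ Some e) <<rooted_incidence K o>>)%MS.
  apply: submx_trans (connect_sub_incidence conn_e) _.
  apply/sumsmx_subP => f /setD1P[fe fT]; apply: (sumsmx_sup (Some f)) => //.
  by rewrite in_setD1 mem_rooted fT andbT; apply: contra fe => /eqP[->].
have sub_gram : (gram (rooted T) <=
    \sum_(o in rooted T :\ Some e) <<rooted_incidence K o>>)%MS.
  apply: summx_sub => o oS; apply: submx_trans (submxMl _ _) _.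
  have [-> // | oe] := eqVneq o (Some e).
  by apply: (sumsmx_sup o); rewrite ?in_setD1 ?oe ?genmxE.
have := leq_trans (mxrankS sub_gram) (rank_sum_gen_le _).
have V_gt0 : (0 < #|V|)%N by rewrite -cardT card_rooted.
have -> : #|rooted T :\ Some e| = #|V|.-1.
  by have /(congr1 predn) := cardsD1 (Some e) (rooted T); rewrite eS cardT.
move=> rk; apply/eqP; apply: contraLR rk; rewrite -unitfE -unitmxE => /mxrank_unit->.
by rewrite -ltnNge prednK.
Qed.

(** Writing [e_x = (e_x - e_r) + e_r] shows that the rooted incidence vectors span the whole
    space. *)
Lemma connected_card_rooted T : connected (edge_rel T) -> (#|V| <= #|rooted T|)%N.
Proof.
move=> conn; rewrite -[leqLHS](mxrank1 K).
apply: leq_trans (rank_sum_gen_le _); apply: mxrankS.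
apply/row_subP => j; rewrite row1 -[j]enum_valK.
rewrite -/(vertex_row K _) -(subrK (vertex_row K r) (vertex_row K _)) addmx_sub //.
  apply: submx_trans (connect_sub_incidence (conn _ _)) _.
  by apply/sumsmx_subP => f fT; apply: (sumsmx_sup (Some f)); rewrite ?mem_rooted.
by apply: (sumsmx_sup None); rewrite ?mem_rooted ?genmxE.
Qed.

End Field.

(* Dual basis of the rooted incidence vectors of a tree: removing the edge [f]
   splits the tree in two, and the potential of [f] is the indicator function
   of the side of [src f], shifted so as to vanish at the root. *)
Definition tree_potential (T : {set edge adj}) (o : option (edge adj)) (v : V) : int :=
  if o is Some f then
    (connect (edge_rel (T :\ f)) (src f) v)%:R
      - (connect (edge_rel (T :\ f)) (src f) r)%:R
  else 1.

(** With [g] removed, any other edge of [T] keeps both ends on one side, while acyclicity separates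
    the ends of [g]. *)
Lemma tree_potential_dual T o1 o2 :
    acyclic (edge_rel T) -> o1 \in rooted T -> o2 \in rooted T ->
  rooted_incidence int o1 *m (\col_i tree_potential T o2 (enum_val i))
    = (o1 == o2)%:R%:M.
Proof.
move/acyclic_edge_rel=> acyc; rewrite !mem_rooted.
case: o1 o2 => [f|] [g|] fT gT.
- rewrite edge_potential_mul /= opprB subrKA; congr (_%:M).
  have [[<-] | fg] := eqVneq (Some f) (Some g).
    by rewrite connect0 (negPf (acyc f fT)) subr0.
  have fTg : f \in T :\ g by rewrite !inE fT andbT; apply: contraNneq fg => ->.
  have conn_f := connect1 (edge_rel_edge fTg).
  by rewrite (same_connect_r (@connect_edge_sym _ _ (T :\ g)) conn_f) subrr.
- by rewrite edge_potential_mul /= subrr.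
- by rewrite vertex_potential_mul /= subrr.
- by rewrite vertex_potential_mul.
Qed.

Lemma rooted_incidence_intr (K : pzRingType) (o : option (edge adj)) :
  map_mx intr (rooted_incidence int o) = rooted_incidence K o.
Proof. by case: o => [f|]; rewrite /= ?map_mxB !map_delta_mx. Qed.

(** This integral right inverse serves twice: its shape bounds [#|rooted T|] by [#|V|], and its
    integrality makes the Gram determinant of a tree equal to 1. *)
Lemma spanning_tree_dual (T : {set edge adj}) :
    acyclic (edge_rel T) ->
  exists D : 'M[int]_(#|V|, #|rooted T|),
    (\matrix_(k < #|rooted T|) rooted_incidence int (enum_val k)) *m D = 1%:M.
Proof.
move=> acyc; exists (\matrix_(i, k) tree_potential T (enum_val k) (enum_val i)).
apply/matrixP => k l; rewrite mxE.
have := tree_potential_dual acyc (enum_valP k) (enum_valP l).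
move/matrixP/(_ 0 0); rewrite !mxE eqxx mulr1n (inj_eq enum_val_inj) => <-.
by apply: eq_bigr => i _; rewrite !mxE.
Qed.

Lemma card_spanning_tree (T : {set edge adj}) :
  spanning_tree T -> #|rooted T| = #|V|.
Proof.
case=> conn /spanning_tree_dual[D /mulmx1_min le_TV].
by apply/eqP; rewrite eqn_leq le_TV (connected_card_rooted rat conn).
Qed.

Lemma det_gram_spanning_tree (K : fieldType) (T : {set edge adj}) :
  spanning_tree T -> \det (gram K (rooted T)) = 1.
Proof.
move=> treeT; have cardT := card_spanning_tree treeT.
case: treeT => _ /spanning_tree_dual[D BD].
have := congr1 (intr : int -> K) (det_unimodular_gram BD cardT).
rewrite -det_map_mx rmorph1 => <-; congr determinant.
rewrite map_mxM -map_trmx /gram big_enum_val /=; apply/matrixP => i j.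
rewrite summxE mxE; apply: eq_bigr => k _.
by rewrite mxE big_ord1 -rooted_incidence_intr !mxE.
Qed.

Lemma weighted_matrix_tree (K : fieldType) (w : edge adj -> K) :
  \det (\sum_f w f *: ((rooted_incidence K (Some f))^T *m rooted_incidence K (Some f))
        + (vertex_row K r)^T *m vertex_row K r)
    = \sum_(T : {set edge adj} | `[< spanning_tree T >]) \prod_(f in T) w f.
Proof.
(* The half-edge gets weight 1, which turns the matrix into a single weighted sum of rank-one
   terms. *)
pose w' o := if o is Some f then w f else 1.
transitivity (\det (\sum_o w' o *: ((rooted_incidence K o)^T *m rooted_incidence K o))).
  congr determinant; rewrite (bigD1 None) //= scale1r addrC; congr (_ + _).
  rewrite (reindex_omap Some id) //=; last by case.
  by apply: eq_bigl => f; rewrite eqxx.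
rewrite det_sum_rank1.
rewrite (bigID (fun S : {set option (edge adj)} => None \in S)) /=.
rewrite addrC big1 ?add0r; last first.
  by move=> S /andP[_ NS]; rewrite -/(gram K S) det_gram_unrooted ?mulr0.
(* Sets containing the half-edge correspond to edge sets through [rooted]. *)
rewrite (reindex_onto rooted (fun S => [set f | Some f \in S])) /=; last first.
  by move=> S /andP[_ NS]; apply/setP => -[f|]; rewrite mem_rooted ?inE.
rewrite (bigID (fun T : {set edge adj} => `[< spanning_tree T >])) /= addrC big1 ?add0r.
  apply: eq_big => [T | T treeT].
    have -> : [set f | Some f \in rooted T] = T.
      by apply/setP => f; rewrite inE mem_rooted.
    rewrite mem_rooted eqxx !andbT; apply: andb_idl => /asboolP treeT.
    by rewrite card_spanning_tree.
  have /asboolP/det_gram_spanning_tree -> : `[< spanning_tree T >] by case/andP: treeT.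
  rewrite mulr1 big_setU1 /=; last by apply/imsetP => -[].
  by rewrite mul1r big_imset //= => f g _ _ [].
(* An edge set of the right size that is not a tree is disconnected or has a cycle. *)
move=> T /andP[/andP[/andP[/eqP cardT _] _] /asboolP not_tree].
rewrite -/(gram K (rooted T)).
have [conn | /det_gram_disconnected->] := pselect (connected (edge_rel T));
  last exact: mulr0.
by rewrite det_gram_cyclic ?mulr0 // => acyc; apply: not_tree.
Qed.
End RootedIncidence.

(** * Spectrum of the Laplacian *)

Section Laplacian.
Variables (R : realType) (V : finType) (adj : rel V).
Implicit Types w : {ffun edge adj -> R}.

Lemma laplacianE (r : V) w :
  laplacian w = \sum_f w f *:
    ((rooted_incidence r R (Some f))^T *m rooted_incidence r R (Some f)).
Proof.
apply: eq_bigr => f _; congr (_ *: _); rewrite /rooted_incidence /vertex_row.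
by rewrite !linearB /= !trmx_delta.
Qed.

Lemma laplacian_sym w : (laplacian w)^T = laplacian w.
Proof.
rewrite linear_sum; apply: eq_bigr => f _.
by rewrite linearZ /= trmx_mul trmxK.
Qed.

Lemma laplacian_quadratic w (v : 'rV[R]_#|V|) :
  (v *m laplacian w *m v^T) 0 0
    = \sum_f w f * (v 0 (enum_rank (src f)) - v 0 (enum_rank (tgt f))) ^+ 2.
Proof.
rewrite mulmx_sumr mulmx_suml summxE; apply: eq_bigr => f _.
rewrite -scalemxAr -scalemxAl mxE; congr (_ * _).
have vb : v *m (basis_vec R (src f) - basis_vec R (tgt f))
    = (v 0 (enum_rank (src f)) - v 0 (enum_rank (tgt f)))%:M.
  by rewrite mulmxBr /basis_vec -!colE raddfB /= [X in X - _]mx11_scalar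
    [X in _ - X]mx11_scalar !mxE.
by rewrite mulmxA vb -mulmxA -trmx_mul vb tr_scalar_mx -scalar_mxM mxE eqxx mulr1n.
Qed.

Lemma laplacian_const w (r : V) : laplacian w *m const_mx 1 = 0 :> 'cV_#|V|.
Proof.
rewrite (laplacianE r) mulmx_suml big1 // => f _.
have -> : const_mx 1 = \col_(i < #|V|) (1 : R) by apply/matrixP => i j; rewrite !mxE.
rewrite -scalemxAl -mulmxA (edge_potential_mul _ (fun=> 1)).
by rewrite subrr raddf0 mulmx0 scaler0.
Qed.

(** The Laplacian is positive semidefinite and kills the all-ones vector, so the least eigenvalue,
    the one dropped by [behead], is 0. *)
Lemma eigenvalues_laplacian w : (0 < #|V|)%N -> (forall f, 0 <= w f) ->
  eigenvalues (laplacian w) = 0 :: spectrum w.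
Proof.
move=> V_gt0 w_ge0; have charL := prod_eigenvalues (laplacian_sym w).
have memE x : (x \in eigenvalues (laplacian w)) = eigenvalue (laplacian w) x.
  by rewrite eigenvalue_root_char charL root_prod_XsubC.
have ge0 x : x \in eigenvalues (laplacian w) -> 0 <= x.
  rewrite memE => /eigenvalueP[v vL nz_v].
  have vv_gt0 : 0 < (v *m v^T) 0 0.
    have [j nz_vj] : exists j, v 0 j != 0.
      by apply/existsP; apply: contraNT nz_v; rewrite negb_exists => /forallP v0;
         apply/eqP/rowP => j; rewrite mxE; apply/eqP; rewrite -[_ == _]negbK v0.
    rewrite mxE (bigD1 j) //= !mxE ltr_wpDr ?sumr_ge0 //.
      by move=> i _; rewrite mxE -expr2 sqr_ge0.
    by rewrite -expr2 exprn_even_gt0.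
  rewrite -(pmulr_lge0 x vv_gt0).
  have -> : x * (v *m v^T) 0 0 = (v *m laplacian w *m v^T) 0 0.
    by rewrite vL -scalemxAl [RHS]mxE.
  by rewrite laplacian_quadratic sumr_ge0 // => f _; rewrite mulr_ge0 ?sqr_ge0.
have zero_in : 0 \in eigenvalues (laplacian w).
  rewrite memE; apply/eigenvalueP; exists (const_mx 1); last first.
    apply/eqP => /matrixP/(_ 0 (Ordinal V_gt0)).
    by rewrite !mxE => /eqP; rewrite oner_eq0.
  rewrite scale0r; apply: trmx_inj; rewrite trmx_mul laplacian_sym trmx_const trmx0.
  exact/laplacian_const/enum_val/(Ordinal V_gt0).
have : sorted <=%R (eigenvalues (laplacian w)) by apply: sort_le_sorted.
rewrite /spectrum; case: (eigenvalues _) ge0 zero_in => [//|x s] ge0 zero_in srt.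
congr (_ :: _); apply/eqP; rewrite eq_le ge0 ?mem_head // andbT.
move: zero_in; rewrite inE => /orP[/eqP-> // | /(allP (order_path_min le_trans srt))].
exact.
Qed.

Lemma sorted_spectrum w : sorted <=%R (spectrum w).
Proof.
have : sorted <=%R (eigenvalues (laplacian w)) by apply: sort_le_sorted.
by rewrite /spectrum; case: (eigenvalues _) => //= x s /path_sorted.
Qed.

Lemma spectrum_ge0 w x : (0 < #|V|)%N -> (forall f, 0 <= w f) ->
  x \in spectrum w -> 0 <= x.
Proof.
move=> V_gt0 w_ge0.
have : sorted <=%R (eigenvalues (laplacian w)) by apply: sort_le_sorted.
by rewrite eigenvalues_laplacian //= => /(order_path_min le_trans)/allP/(_ x).
Qed.

Lemma size_spectrum w : size (spectrum w) = #|V|.-1.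
Proof.
have := congr1 (fun p : {poly R} => size p) (prod_eigenvalues (laplacian_sym w)).
by rewrite /= size_char_poly size_prod_XsubC => -[->]; rewrite size_behead.
Qed.

Lemma prod_spectrum w : (0 < #|V|)%N -> (forall f, 0 <= w f) ->
  \prod_(x <- spectrum w) x = #|V|%:R * tau w.
Proof.
(* The root is the vertex of rank 0, so that [N], whose only nonzero column is the all-ones column
   [i0], is lower triangular. *)
move=> V_gt0 w_ge0; pose i0 := Ordinal V_gt0; pose r := enum_val i0.
pose one : 'cV[R]_#|V| := const_mx 1; pose e0 : 'rV[R]_#|V| := delta_mx 0 i0.
pose L := laplacian w; pose N := one *m e0.
have L1 : L *m one = 0 by apply: laplacian_const.
have NE i j : N i j = (j == i0)%:R by rewrite !mxE big_ord1 !mxE mul1r.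
have charN : char_poly N = ('X - 1) * 'X ^+ #|V|.-1.
  rewrite char_poly_trig; last first.
    apply/is_trig_mxP => i j lt_ij; rewrite NE; case: eqP => // j0.
    by rewrite j0 in lt_ij.
  rewrite (bigD1 i0) //= NE eqxx; congr (_ * _).
  rewrite (eq_bigr (fun=> 'X)) => [|i /negPf i_neq]; last by rewrite NE i_neq subr0.
  by rewrite prodr_const cardC1 card_ord.
have charL : char_poly L = 'X * \prod_(x <- spectrum w) ('X - x%:P).
  by rewrite prod_eigenvalues ?laplacian_sym // eigenvalues_laplacian // big_cons subr0.
have det_LN : \det (L + N) = \prod_(x <- spectrum w) x.
  have LN0 : L *m N = 0 by rewrite mulmxA L1 mul0mx.
  have E : \prod_(x <- spectrum w) ('X - x%:P) * ('X - 1) = char_poly (L + N).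
    apply: (@mulfI _ ('X ^+ #|V|)); first by rewrite expf_neq0 ?polyX_eq0.
    have XE : 'X ^+ #|V| = 'X * 'X ^+ #|V|.-1 :> {poly R} by rewrite -exprS prednK.
    rewrite -(char_poly_add_annihilated LN0) charL charN XE; ring.
  (* At 0 the right side is [(-1)^n] times the determinant, and the left side is [(-1)^(n-1)] times
     the product, times -1. *)
  move/(congr1 (fun p : {poly R} => p.[0])): E.
  rewrite hornerM hornerXsubC !horner_coef0 char_poly_det coef0_prod_XsubC sub0r.
  have signE : (-1) ^+ #|V| = - (-1) ^+ #|V|.-1 :> R.
    by rewrite -[RHS]mulN1r -exprS prednK.
  rewrite size_spectrum signE mulrN1 mulNr => /oppr_inj.
  by move/esym/mulfI; apply; rewrite expf_neq0 ?oppr_eq0 ?oner_eq0.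
(* Since [one^T L = 0] and [one^T e0^T = 1], multiplying by [P] fixes [L] and turns [e0^T e0] into
   [N]. The factor [n] is [det P = 1 + (n - 1)]. *)
pose u := one - e0^T; pose P := 1%:M + u *m one^T.
have P_LN : P *m (L + e0^T *m e0) = L + N.
  have one_L : one^T *m L = 0 by rewrite -[L]trmxK [L^T]laplacian_sym -trmx_mul L1 trmx0.
  have one_e0 : one^T *m e0^T = 1%:M.
    by rewrite -trmx_mul -rowE [X in X^T]mx11_scalar tr_scalar_mx !mxE.
  rewrite /P mulmxDr 2!mulmxDl !mul1mx -!mulmxA one_L mulmx0 addr0; congr (_ + _).
  by rewrite [one^T *m _]mulmxA one_e0 mul1mx mulmxBl addrC subrK.
have det_P : \det P = #|V|%:R.
  rewrite det_1_add_rank1 mxE.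
  under eq_bigr do rewrite !mxE mul1r.
  rewrite sumrB sumr_const card_ord (bigD1 i0) //= big1 => [|i /negPf-> //].
  by rewrite addr0 addrC subrK.
rewrite -det_LN -P_LN det_mulmx det_P /tau -(weighted_matrix_tree r w).
rewrite -laplacianE /vertex_row enum_valK; congr (_ * _).
Qed.
End Laplacian.

(** * Comparison of spanning tree sums *)

Lemma tau_le_of_sum_smallest_le (R : realType) (V : finType) (adj : rel V)
    (w w' : {ffun edge adj -> R}) :
    (0 < #|V|)%N -> (forall f, 0 <= w f) -> (forall f, 0 <= w' f) ->
    (forall k, (1 <= k <= #|V| - 1)%N -> sum_smallest k w <= sum_smallest k w') ->
  tau w <= tau w'.
Proof.
move=> V_gt0 w_ge0 w'_ge0 le_ww'.
have V_gt0R : 0 < #|V|%:R :> R by rewrite ltr0n.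
rewrite -(ler_pM2l V_gt0R) -!prod_spectrum //.
rewrite (big_nth 0) [leRHS](big_nth 0) !big_mkord !size_spectrum.
have nth_ge0 (v : {ffun edge adj -> R}) i : (forall f, 0 <= v f) -> (i < #|V|.-1)%N ->
    0 <= (spectrum v)`_i.
  by move=> v_ge0 lt_i; apply: spectrum_ge0 v_ge0 _ => //; rewrite mem_nth ?size_spectrum.
apply: (@ler_prod_of_ler_partial_sums _ _ (nth 0 (spectrum w)) (nth 0 (spectrum w'))).
- by move=> i; apply: nth_ge0.
- by move=> i; apply: nth_ge0.
- move=> i lt_i; apply: (sorted_leq_nth le_trans lexx 0 (sorted_spectrum w'));
    by rewrite ?inE ?size_spectrum // ltnW.
(* The hypothesis starts at [k = 1], so the empty sum is treated apart. *)
move=> [|k] le_k; first by rewrite !big_ord0.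
have sumE (v : {ffun edge adj -> R}) :
    \sum_(i < k.+1) (spectrum v)`_i = sum_smallest k.+1 v.
  rewrite /sum_smallest [RHS](big_nth 0) big_mkord size_takel ?size_spectrum //.
  by apply: eq_bigr => i _; rewrite nth_take.
by rewrite !sumE; apply: le_ww'; rewrite subn1 le_k.
Qed.

Theorem mainTheorem18 (R : realType) (V : finType) (adj : rel V)
    (adj_sym : symmetric adj) (adj_irr : irreflexive adj)
    (adj_conn : connected adj) (adj_edge : exists x y : V, adj x y)
    (rigid : totally_conformally_rigid R adj) :
  normalized (ones R adj) /\
  forall w : {ffun edge adj -> R}, normalized w -> tau w <= tau (ones R adj).
Proof.
have norm1 : normalized (ones R adj).
  split=> [f | ]; first by rewrite ffunE ler01.
  under eq_bigr do rewrite ffunE.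
  by rewrite sumr_const.
split=> // w norm_w; have [x _] := adj_edge.
apply: tau_le_of_sum_smallest_le => [|||k k_range]; first by apply/card_gt0P; exists x.
- by case: norm_w.
- by case: norm1.
by have [] := rigid k k_range w w norm_w norm_w.
Qed.
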